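(* Let $n>3$ be a positive integer. Then the complete bipartite graph $K_{n,n}$ is a weak ordered super TAT graph; that is, $K_{n,n}$ admits a total labeling that is simultaneously super, totally antimagic total, and weak ordered.
   Context: All graphs are finite, undirected and simple. $K_{n,n}$ is the complete bipartite graph with $n$ vertices in each partite set. Let $G$ be a graph with $p=|V(G)|$ vertices and $q=|E(G)|$ edges. A total labeling of $G$ is a bijection $f:V(G)\cup E(G)\to\{1,2,\dots,p+q\}$. It is super if $f(V(G))=\{1,2,\dots,p\}$. The edge-weight of $uv\in E(G)$ is $wt_f(uv)=f(u)+f(uv)+f(v)$, and the vertex-weight of $v\in V(G)$ is $wt_f(v)=f(v)+\sum_{u\in N(v)}f(uv)$, where $N(v)$ is the set of neighbors of $v$. The labeling $f$ is edge-antimagic total (EAT) if all edge-weights are pairwise distinct, and vertex-antimagic total (VAT) if all vertex-weights are pairwise distinct. It is totally antimagic total (TAT) if it is both EAT and VAT. A labeling $f$ is ordered on a set $S$ of vertices if $wt_f(u)\le wt_f(v)$ for every pair $u,v\in S$ with $f(u)<f(v)$. A labeling $f$ of $G$ is weak ordered if, for some positive integer $k$, the vertex set $V(G)$ can be partitioned into $k$ sets on each of which $f$ is ordered. A graph is a weak ordered super TAT graph if it admits a total labeling that is weak ordered, super and TAT. *)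

(* Defs.v *)
From mathcomp Require Import all_boot.
Set Implicit Arguments.
Unset Strict Implicit.
Unset Printing Implicit Defensive.

Record sgraph := SGraph {
  vertex :> finType;
  adj : rel vertex;
  adj_sym : symmetric adj;
  adj_irrefl : irreflexive adj
}.

Section TotalLabelings.
Variable G : sgraph.

Definition neighbors (v : G) : {set G} := [set u | adj v u].

(* The edge uv is the two-element set [set u; v]. *)
Definition edges : {set {set G}} :=
  [set e : {set G} | [exists u, exists v, adj u v && (e == [set u; v])]].

Definition gorder : nat := #|G|.
Definition gsize : nat := #|edges|.

(* The disjoint union of V(G) and E(G). *)
Definition elements : {set G + {set G}} :=
  [set x | match x with inl _ => true | inr e => e \in edges end].

(* A labeling of V(G) and E(G) is a function on all of [G + {set G}]; every
   notion below only looks at its values on [elements]. *)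
Definition labeling := G + {set G} -> nat.

Definition vlabel (f : labeling) (v : G) : nat := f (inl v).
Definition elabel (f : labeling) (u v : G) : nat := f (inr [set u; v]).

Definition total_labeling (f : labeling) : Prop :=
  {in elements &, injective f} /\
  [seq f x | x in elements] =i [pred k | 1 <= k <= gorder + gsize].

Definition super (f : labeling) : Prop :=
  [seq vlabel f v | v : G] =i [pred k | 1 <= k <= gorder].

Definition edge_weight (f : labeling) (u v : G) : nat :=
  vlabel f u + elabel f u v + vlabel f v.

Definition vertex_weight (f : labeling) (v : G) : nat :=
  vlabel f v + \sum_(u in neighbors v) elabel f u v.

Definition edge_antimagic_total (f : labeling) : Prop :=
  forall u v x y : G, adj u v -> adj x y ->
    [set u; v] != [set x; y] -> edge_weight f u v <> edge_weight f x y.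

Definition vertex_antimagic_total (f : labeling) : Prop :=
  forall u v : G, u != v -> vertex_weight f u <> vertex_weight f v.

Definition totally_antimagic_total (f : labeling) : Prop :=
  edge_antimagic_total f /\ vertex_antimagic_total f.

Definition ordered_on (f : labeling) (S : {set G}) : Prop :=
  {in S &, forall u v : G,
    vlabel f u < vlabel f v -> vertex_weight f u <= vertex_weight f v}.

Definition weak_ordered (f : labeling) : Prop :=
  exists k : nat, 0 < k /\
    exists P : {set {set G}},
      [/\ partition P [set: G], #|P| = k & {in P, forall S, ordered_on f S}].

Definition weak_ordered_super_TAT_graph : Prop :=
  exists f : labeling,
    [/\ total_labeling f, super f, totally_antimagic_total f
      & weak_ordered f].

End TotalLabelings.

Section CompleteBipartite.
Variable n : nat.

Definition is_left (x : 'I_n + 'I_n) : bool :=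
  match x with inl _ => true | inr _ => false end.

Definition Knn_adj : rel ('I_n + 'I_n)%type :=
  fun x y => is_left x != is_left y.

Lemma Knn_adj_sym : symmetric Knn_adj.
Proof. by move=> x y; rewrite /Knn_adj eq_sym. Qed.

Lemma Knn_adj_irrefl : irreflexive Knn_adj.
Proof. by move=> x; rewrite /Knn_adj eqxx. Qed.

Definition Knn : sgraph := SGraph Knn_adj_sym Knn_adj_irrefl.

End CompleteBipartite.

(* Main.v *)
(* Label the left vertices with the odd numbers [2i + 1], the right vertices
   with the even numbers [2(n - j)], and the edges row by row with
   [2n + 1 + (ni + j)]. The edge-weights are then [4n + 2 + (n + 2)i - j],
   which are distinct because [j < n + 2]. Left vertex-weights are an arithmetic
   progression of step [n^2 + 2], right ones of step [n - 2]; putting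
   [d = 2i - (n - 1)], a left weight equals a right one iff
   [(n^2 + 2)d + n(n - 3) = 2(n - 2)j]. As [0 <= j < n] this forces [d = 0], so
   [n] is odd and [n - 2] divides [2], that is [n = 3]. Weak orderedness is free:
   use the partition into singletons. *)
Require Import Defs.
From mathcomp Require Import all_boot.
From mathcomp Require Import zify.
Set Implicit Arguments.
Unset Strict Implicit.
Unset Printing Implicit Defensive.

(** * Weak orderedness via singletons *)

Lemma partition_set1 (T : finType) (A : {set T}) :
  partition [set [set x] | x in A] A.
Proof.
rewrite -(_ : preim_partition id A = [set [set x] | x in A]).
  exact: preim_partitionP.
apply: eq_in_imset => x xA; apply/setP => y; rewrite !inE /= eq_sym.
by case: eqP => [->|]; rewrite ?xA ?andbF.
Qed.

Lemma weak_ordered_nonempty (G : sgraph) (f : labeling G) :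
  0 < #|G| -> weak_ordered f.
Proof.
move=> G_gt0; exists #|[set [set x] | x in [set: G]]|.
rewrite card_imset; last exact: set1_inj.
rewrite cardsT; split => //; exists [set [set x] | x in [set: G]].
split; [exact: partition_set1 | by rewrite card_imset ?cardsT //; exact: set1_inj |].
(* On a singleton the strict premise compares a label with itself. *)
move=> _ /imsetP[x _ ->] u v; rewrite !inE => /eqP-> /eqP->.
by rewrite ltnn.
Qed.

(** * Edges and neighborhoods of [Knn n] *)

Section BipartiteEdges.
Variable n : nat.

Definition Knn_edge (i j : 'I_n) : {set Knn n} := [set inl i; inr j].

Lemma Knn_edge_inj i j i' j' :
  Knn_edge i j = Knn_edge i' j' -> (i, j) = (i', j').
Proof.
move=> /setP eqE; move: (eqE (inl i)) (eqE (inr j)).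
rewrite !inE !eqxx !orbT /= !orbF => /esym/eqP[->].
by move/esym/eqP => [->].
Qed.

(** Either end may be the left one, so both orientations are kept for computing weights. *)
Lemma Knn_adjE (u v : Knn n) :
  adj u v -> exists i j, [set u; v] = Knn_edge i j /\
    ((u = inl i /\ v = inr j) \/ (u = inr j /\ v = inl i)).
Proof.
case: u v => [i|j] [i'|j'] //= _; first by exists i, j'; split; [|left].
by exists i', j; rewrite setUC; split; [|right].
Qed.

Lemma Knn_edgesE : edges (Knn n) = [set Knn_edge p.1 p.2 | p : 'I_n * 'I_n].
Proof.
apply/setP => e; rewrite inE; apply/existsP/imsetP.
  move=> [u /existsP[v /andP[uv /eqP->]]].
  by have [i [j [-> _]]] := Knn_adjE uv; exists (i, j).
move=> [[i j] _ ->]; exists (inl i); apply/existsP; exists (inr j).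
exact/andP.
Qed.

Lemma Knn_order : gorder (Knn n) = n + n.
Proof. by rewrite /gorder /= card_sum !card_ord. Qed.

Lemma Knn_size : gsize (Knn n) = n * n.
Proof.
rewrite /gsize Knn_edgesE card_imset ?card_prod ?card_ord //.
by move=> [i j] [i' j'] /Knn_edge_inj.
Qed.

Lemma Knn_sum_neighbors_inl i (F : Knn n -> nat) :
  \sum_(u in @neighbors (Knn n) (inl i)) F u = \sum_(j < n) F (inr j).
Proof.
rewrite (eq_bigl (fun u => @adj (Knn n) (inl i) u)); last by move=> u; rewrite inE.
by rewrite big_sumType /= big_pred0_eq add0n; apply: eq_bigl.
Qed.

Lemma Knn_sum_neighbors_inr j (F : Knn n -> nat) :
  \sum_(u in @neighbors (Knn n) (inr j)) F u = \sum_(i < n) F (inl i).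
Proof.
rewrite (eq_bigl (fun u => @adj (Knn n) (inr j) u)); last by move=> u; rewrite inE.
by rewrite big_sumType /= big_pred0_eq addn0; apply: eq_bigl.
Qed.

End BipartiteEdges.

(* With [n = m + 2], this is the equation [(n^2 + 2)d + n(n - 3) = 2(n - 2)j]
   for [d = 2i - (n - 1)], rearranged to avoid subtraction. *)
Lemma double_progressions_disjoint m i j : 1 < m -> j < m.+2 ->
  (m.+2 * m.+2 + 2) * i.*2 + m.+2 * m.+2
    <> (m.+2 * m.+2 + 2) * m.+1 + m.+2 * 3 + (m * j).*2.
Proof.
move=> m_gt1 lt_j; set c := m.+2 * m.+2 + 2 => eq_c.
have le_mj : m * j <= m * m.+1 by rewrite leq_mul2l -ltnS lt_j orbT.
have c_def : c = m * m + 4 * m + 6 by rewrite /c; lia.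
have [lt_d|gt_d|eq_d] := ltngtP i.*2 m.+1.
(* As [c = n^2 + 2] with [n = m + 2], a surplus of [c] on the right exceeds the left term [n^2]. *)
- have : c * i.*2.+1 <= c * m.+1 by rewrite leq_mul2l lt_d orbT.
  rewrite mulnS; lia.
(* The left surplus is at least [c + n^2], which exceeds [3n + 2m(m + 1)], a bound for what remains
   on the right. *)
- have : c * m.+2 <= c * i.*2 by rewrite leq_mul2l gt_d orbT.
  rewrite mulnS; lia.
(* Here [m = 2i - 1], so [m] would divide 1, against [1 < m]. *)
have : i.*2.-1 * i = i.*2.-1 * j + 1 by move: eq_c; rewrite eq_d; nia.
have [lt_ij|gt_ij|->] := ltngtP i j; last by lia.
- have : i.*2.-1 * i <= i.*2.-1 * j by rewrite leq_mul2l ltnW ?orbT.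
  lia.
have : i.*2.-1 * j.+1 <= i.*2.-1 * i by rewrite leq_mul2l gt_ij orbT.
rewrite mulnS; lia.
Qed.

(** * The labeling and its range of values *)

Section Labeling.
Variable n : nat.

Definition Knn_vlabel (v : Knn n) : nat :=
  match v with inl i => i.*2.+1 | inr j => (n - j).*2 end.

(* Summing over the two ends of an edge avoids having to choose which one is
   the left end. *)
Definition Knn_elabel (e : {set Knn n}) : nat :=
  n.*2.+1 + \sum_(v in e) match v with inl i => n * i | inr j => val j end.

Definition Knn_label : labeling (Knn n) :=
  fun x => match x with inl v => Knn_vlabel v | inr e => Knn_elabel e end.

Lemma Knn_elabelE i j : Knn_elabel (Knn_edge i j) = n.*2.+1 + (n * i + j).
Proof. by rewrite /Knn_elabel /Knn_edge big_setU1 ?inE //= big_set1. Qed.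

Lemma Knn_elabel_lr i j :
  elabel Knn_label (inl i) (inr j) = n.*2.+1 + (n * i + j).
Proof. exact: Knn_elabelE. Qed.

Lemma Knn_elabel_rl i j :
  elabel Knn_label (inr j) (inl i) = n.*2.+1 + (n * i + j).
Proof. by rewrite /elabel setUC; apply: Knn_elabelE. Qed.

Lemma Knn_vlabel_inj : injective Knn_vlabel.
Proof.
move=> [i|j] [i'|j'] /= eq_l.
- by congr inl; apply: val_inj => /=; lia.
- lia.
- lia.
- by congr inr; apply: val_inj => /=; have := ltn_ord j; have := ltn_ord j'; lia.
Qed.

Lemma row_major_inj (i j i' j' : 'I_n) :
  n * i + j = n * i' + j' -> (i, j) = (i', j').
Proof.
have := ltn_ord j; have := ltn_ord j' => lt_j' lt_j eq_ij.
have n_gt0 : 0 < n by apply: leq_ltn_trans lt_j.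
have eq_i : i = i' :> nat.
  have := congr1 (divn^~ n) eq_ij.
  by rewrite ![n * _]mulnC !divnMDl // !divn_small ?addn0.
by congr (_, _); apply: val_inj => //=; move: eq_ij; rewrite eq_i => /addnI.
Qed.

Lemma Knn_vlabel_bound v : 1 <= Knn_vlabel v <= n.*2.
Proof.
by case: v => [i|j] /=; [have := ltn_ord i | have := ltn_ord j]; lia.
Qed.

Lemma Knn_vlabel_onto k : 1 <= k <= n.*2 -> exists v, k = Knn_vlabel v.
Proof.
move=> k_bd; have [k_odd|k_even] := boolP (odd k).
  have lt_k : k./2 < n by lia.
  by exists (inl (Ordinal lt_k)) => /=; lia.
(* An even [k] in range is at least 2, so this index is below [n]. *)
have lt_k : n - k./2 < n by lia.
by exists (inr (Ordinal lt_k)) => /=; lia.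
Qed.

(** Euclidean division of [k - (2n + 1)] by [n] inverts the row-major numbering. *)
Lemma Knn_elabel_onto k : n.*2 < k <= n.*2 + n * n ->
  exists i j, k = Knn_elabel (Knn_edge i j).
Proof.
move=> k_bd; have n_gt0 : 0 < n by nia.
have lt_i : (k - n.*2.+1) %/ n < n by rewrite ltn_divLR //; lia.
have lt_j : (k - n.*2.+1) %% n < n by rewrite ltn_mod.
exists (Ordinal lt_i), (Ordinal lt_j); rewrite Knn_elabelE /= mulnC -divn_eq.
lia.
Qed.

Lemma Knn_label_super : super Knn_label.
Proof.
move=> k; rewrite !inE Knn_order addnn; apply/mapP/idP => [[v _ ->]|].
  exact: Knn_vlabel_bound.
by move=> /Knn_vlabel_onto[v ->]; exists v; rewrite ?mem_enum.
Qed.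

Lemma Knn_elabel_bound i j :
  n.*2 < Knn_elabel (Knn_edge i j) <= n.*2 + n * n.
Proof. by rewrite Knn_elabelE; have := ltn_ord i; have := ltn_ord j; nia. Qed.

Lemma mem_elements_inr e :
  (inr e \in elements (Knn n)) = (e \in [set Knn_edge p.1 p.2 | p : 'I_n * 'I_n]).
Proof. by rewrite inE Knn_edgesE. Qed.

Lemma Knn_label_total : total_labeling Knn_label.
Proof.
split=> [[v|e] [w|e']|k]; rewrite ?mem_elements_inr /=.
- by move=> _ _ /Knn_vlabel_inj->.
- move=> _ /imsetP[[i j] _ ->] eq_l.
  by have := Knn_vlabel_bound v; have := Knn_elabel_bound i j; rewrite -eq_l; lia.
- move=> /imsetP[[i j] _ ->] _ eq_l.
  by have := Knn_vlabel_bound w; have := Knn_elabel_bound i j; rewrite eq_l; lia.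
- move=> /imsetP[[i j] _ ->] /imsetP[[i' j'] _ ->] /=.
  by rewrite !Knn_elabelE => /addnI/row_major_inj[-> ->].
rewrite inE Knn_order Knn_size addnn; apply/imageP/idP.
  move=> [[v _ ->|e]]; first by have := Knn_vlabel_bound v => /=; lia.
  rewrite mem_elements_inr => /imsetP[[i j] _ ->] -> /=.
  by have := Knn_elabel_bound i j; lia.
move=> k_bd; have [k_le|k_gt] := leqP k n.*2.
  have /Knn_vlabel_onto[v ->] : 1 <= k <= n.*2 by lia.
  by exists (inl v); rewrite ?inE.
have /Knn_elabel_onto[i [j ->]] : n.*2 < k <= n.*2 + n * n by lia.
by exists (inr (Knn_edge i j)) => //; rewrite mem_elements_inr (imset_f _ (x := (i, j))).
Qed.

(** Adding [j] on the left avoids truncated subtraction. *)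
Lemma Knn_edge_weightE u v i j :
  (u = inl i /\ v = inr j) \/ (u = inr j /\ v = inl i) ->
  edge_weight Knn_label u v + j = n.*2.*2 + 2 + (n + 2) * i.
Proof.
rewrite /edge_weight /vlabel; have := ltn_ord j.
by move=> lt_j [[-> ->]|[-> ->]]; rewrite ?Knn_elabel_lr ?Knn_elabel_rl /=; nia.
Qed.

Lemma Knn_label_EAT : edge_antimagic_total Knn_label.
Proof.
move=> u v x y /Knn_adjE[i [j [-> uvE]]] /Knn_adjE[i' [j' [-> xyE]]].
move=> /eqP neq_e eq_w; apply: neq_e.
have := Knn_edge_weightE uvE; have := Knn_edge_weightE xyE; rewrite eq_w => w' w.
have := ltn_ord j; have := ltn_ord j' => lt_j' lt_j.
(* Both [j] and [j'] are below [n + 2], so distinct rows have disjoint ranges of weights. *)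
have eq_i : i = i' :> nat by nia.
by congr Knn_edge; apply: val_inj => //=; nia.
Qed.

(** * Vertex-weights *)

Lemma double_sum_ord : (\sum_(i < n) i).*2 = n * n.-1.
Proof.
(* [halfK] subtracts a parity, which is zero because [n * n.-1] is even. *)
rewrite -(big_mkord xpredT id) bin2_sum bin2 halfK oddM.
by case: n => // m; rewrite /= andNb subn0.
Qed.

(** The edges at a left vertex fill one row, so all column indices are summed; doubling clears the
    half in that sum. *)
Lemma Knn_vertex_weight_inl i :
  (vertex_weight Knn_label (inl i)).*2
    = i.*2.+1.*2 + (n * n.*2.+1).*2 + (n * n * i).*2 + n * n.-1.
Proof.
rewrite /vertex_weight Knn_sum_neighbors_inl.
under eq_bigr => j _ do rewrite Knn_elabel_rl.
rewrite !big_split /= !sum_nat_const card_ord -double_sum_ord /vlabel /=.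
by rewrite -!muln2; nia.
Qed.

Lemma Knn_vertex_weight_inr j :
  (vertex_weight Knn_label (inr j)).*2
    = (n - j).*2.*2 + (n * n.*2.+1).*2 + (n * j).*2 + n * (n * n.-1).
Proof.
rewrite /vertex_weight Knn_sum_neighbors_inr.
under eq_bigr => i _ do rewrite Knn_elabel_lr.
rewrite !big_split /= !sum_nat_const card_ord -big_distrr /= -double_sum_ord /vlabel /=.
by rewrite -!muln2; nia.
Qed.

Lemma Knn_vertex_weight_lr i j : 3 < n ->
  vertex_weight Knn_label (inl i) <> vertex_weight Knn_label (inr j).
Proof.
move=> n_gt3 /(congr1 double).
rewrite Knn_vertex_weight_inl Knn_vertex_weight_inr.
have := ltn_ord j; move: (val i) (val j) => /= {}i {}j lt_j eq_w.
have [m def_n] : exists m, n = m.+2 by exists (n - 2); lia.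
have m_gt1 : 1 < m by lia.
apply: (@double_progressions_disjoint m i j) => //; first by rewrite -def_n.
move: eq_w; rewrite doubleB def_n /=; nia.
Qed.

Lemma Knn_label_VAT : 3 < n -> vertex_antimagic_total Knn_label.
Proof.
move=> n_gt3 [i|j] [i'|j'] /eqP neq_uv.
- move=> /(congr1 double); rewrite !Knn_vertex_weight_inl => eq_w; apply: neq_uv.
  by congr inl; apply: val_inj => /=; nia.
- exact: Knn_vertex_weight_lr.
- by move/esym; apply: Knn_vertex_weight_lr.
- move=> /(congr1 double); rewrite !Knn_vertex_weight_inr => eq_w; apply: neq_uv.
  have := ltn_ord j; have := ltn_ord j' => lt_j' lt_j.
  (* The coefficient of [j] in the doubled weight is [2(n - 2)], nonzero since [3 < n]. *)
  by congr inr; apply: val_inj => /=; nia.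
Qed.

End Labeling.

Theorem theorem2p1 (n : nat) (hn : 3 < n) : weak_ordered_super_TAT_graph (Knn n).
Proof.
exists (@Knn_label n); split.
- exact: Knn_label_total.
- exact: Knn_label_super.
- by split; [exact: Knn_label_EAT | exact: Knn_label_VAT].
- by apply: weak_ordered_nonempty; rewrite -/(gorder _) Knn_order; lia.
Qed.
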